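(* Let $\Phi$ be a free metabelian group that is not cyclic. Then there exists a finitely generated subgroup $H \leq \Phi$ such that $H$ is isolated in $\Phi$ and $H$ is not separable in the class of nilpotent groups.
   Context: A free metabelian group is a group of the form $F/F''$, where $F$ is a free group (of arbitrary, possibly infinite, rank) and $F''$ is the second commutator subgroup of $F$, i.e. the commutator subgroup of $F'=[F,F]$. A subgroup $H$ of a group $G$ is called isolated if for every $g \in G$ and every positive integer $m$, the condition $g^m \in H$ implies $g \in H$. Let $\mathcal{K}$ be a class of groups. A subgroup $H$ of a group $G$ is called separable in the class $\mathcal{K}$ if for each $g \in G \setminus H$ there is a homomorphism $\varphi$ from $G$ to some group in $\mathcal{K}$ such that $\varphi(g) \notin \varphi(H)$. *)

(* Defs.v *)
(* MathComp (groupType) together with the classical sets of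
   mathcomp-classical: subgroups of possibly infinite groups are sets. *)
From mathcomp Require Import all_boot.
From mathcomp Require Import boolp classical_sets.

Set Implicit Arguments.
Unset Strict Implicit.
Unset Printing Implicit Defensive.

Local Open Scope classical_set_scope.
Local Open Scope group_scope.

Definition is_subgroup (G : groupType) (H : set G) : Prop :=
  H 1 /\ forall x y : G, H x -> H y -> H (x / y).

Definition subgroup_gen (G : groupType) (A : set G) : set G :=
  [set x | forall H : set G, is_subgroup H -> A `<=` H -> H x].

Definition finitely_generated (G : groupType) (H : set G) : Prop :=
  exists s : seq G, H = subgroup_gen [set` s].

Definition is_cyclic (G : groupType) : Prop :=
  exists g : G, subgroup_gen [set g] = [set: G].

Definition commutator_subgroup (G : groupType) (A B : set G) : set G :=
  subgroup_gen [set z | exists x y : G, [/\ A x, B y & z = [~ x, y]]].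

Definition derived_subgroup (G : groupType) : set G :=
  commutator_subgroup [set: G] [set: G].

Definition second_derived_subgroup (G : groupType) : set G :=
  commutator_subgroup (@derived_subgroup G) (@derived_subgroup G).

(* Indexed from 0: the zeroth term is G itself. *)
Fixpoint lower_central_series (G : groupType) (n : nat) : set G :=
  if n is n'.+1 then
    commutator_subgroup (@lower_central_series G n') [set: G]
  else [set: G].

Definition is_nilpotent (G : groupType) : Prop :=
  exists n : nat, @lower_central_series G n = [set 1].

(* Universal property: every map from X to a group extends uniquely, along i,
   to a homomorphism.  Uniqueness is stated pointwise because an element of
   {multiplicative F -> G} also packs a proof. *)
Definition is_free_on (F : groupType) (X : Type) (i : X -> F) : Prop :=
  forall (G : groupType) (f : X -> G),
    (exists h : {multiplicative F -> G}, forall x : X, h (i x) = f x) /\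
    (forall h1 h2 : {multiplicative F -> G},
       (forall x : X, h1 (i x) = f x) -> (forall x : X, h2 (i x) = f x) ->
       forall y : F, h1 y = h2 y).

Definition is_free_group (F : groupType) : Prop :=
  exists (X : Type) (i : X -> F), is_free_on i.

(* Phi is, up to isomorphism, the quotient F / F'': the image of a
   homomorphism defined on a free group F whose kernel is exactly F''. *)
Definition is_free_metabelian (Phi : groupType) : Prop :=
  exists (F : groupType) (p : {multiplicative F -> Phi}),
    [/\ is_free_group F,
        range p = [set: Phi] &
        p @^-1` [set 1] = @second_derived_subgroup F].

Definition is_isolated (G : groupType) (H : set G) : Prop :=
  forall (g : G) (m : nat), (0 < m)%N -> H (g ^+ m) -> H g.

Definition is_separable (K : groupType -> Prop) (G : groupType)
    (H : set G) : Prop :=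
  forall g : G, ~ H g ->
    exists (N : groupType) (phi : {multiplicative G -> N}),
      K N /\ ~ (phi @` H) (phi g).

(* Main.v *)
From HB Require Import structures.
Require Import Defs.
From mathcomp Require Import all_boot all_order all_algebra.
From mathcomp Require Import boolp classical_sets.
From mathcomp Require Import ring.

(** Let x and y be two elements of a basis of the free metabelian group Phi, K
    the subgroup that they generate and A the derived subgroup of Phi. Let Phi
    act on the rational line so that x is the dilation by 1/2 and every other
    basis element, y among them, is the translation by 1. On K this action factors
    through the Baumslag-Solitar group < x, y | y ^ x = y ^ 2 >. The subgroup H
    consists of the elements of K that fix 0.

    H is not separable. It contains x and the relator y ^ x / y / y, which is
    congruent to y^-1 modulo commutators. So H and K have the same image in every
    abelian quotient of K, and hence in every nilpotent one (nilpotent_mem). But y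
    is in K and moves 0.

    H is finitely generated. With c = y ^ x / y, it is generated by x, the relator
    c / y, and two elements of A that make x square c and y centralise c. Indeed,
    up to a left factor in the subgroup of these four elements, every element of K
    lies in A and is conjugate, by a power of x and modulo that subgroup, to an
    integral power of c (bs_factor). Since c acts as the translation by 1, only
    the trivial power fixes 0 (bs_subgroup_fix0).

    H is isolated. An affine map of positive slope fixes 0 as soon as one of its
    positive powers does (affine_root_fix0), so H is isolated in K. If g ^ m is in
    H with m > 0, the retraction r of Phi onto K gives r(g) ^ m = g ^ m, and
    g = r(g) because roots in Phi are unique (root_uniq). Uniqueness of roots is
    elementary for affine maps of positive slope, and Phi inherits it because it
    is residually a group of such maps (residually_affine). The latter is the
    Magnus embedding specialised at rational points. A word for g traces a path in
    the Cayley graph of Phi / A, whose edges determine elements of A with product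
    conjugate to g when g is in A. If g is trivial in all affine quotients,
    independence of characters shows that the path crosses each edge equally
    often in both directions, so that this product cancels. *)

Set Implicit Arguments.
Unset Strict Implicit.
Unset Printing Implicit Defensive.

Import Order.TTheory GRing.Theory Num.Theory.

Local Open Scope classical_set_scope.
Local Open Scope group_scope.

(** Both sides of an identity that holds in all groups reduce to the same
    left-associated word. *)
Ltac group_normalize :=
  rewrite /commg /conjg ?invgM ?invgK ?mulgA
    ?(mulgK, mulgVK, mulVg, mulgV, mul1g, mulg1, invg1).

(** * Homomorphisms of groups *)

Lemma hom1 (G1 G2 : groupType) (f : {multiplicative G1 -> G2}) : f 1 = 1.
Proof. by apply: (@mulgI _ (f 1)); rewrite -gmulfM !mulg1. Qed.

Lemma homV (G1 G2 : groupType) (f : {multiplicative G1 -> G2}) :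
  {morph f : x / x^-1}.
Proof. by move=> x; apply: (@mulgI _ (f x)); rewrite -gmulfM !mulgV hom1. Qed.

Lemma homF (G1 G2 : groupType) (f : {multiplicative G1 -> G2}) :
  {morph f : x y / x / y}.
Proof. by move=> x y; rewrite gmulfM homV. Qed.

Lemma homX (G1 G2 : groupType) (f : {multiplicative G1 -> G2}) n :
  {morph f : x / x ^+ n}.
Proof.
by move=> x; elim: n => [|n IH]; rewrite ?expg0 ?hom1 // !expgS gmulfM IH.
Qed.

Lemma homJ (G1 G2 : groupType) (f : {multiplicative G1 -> G2}) :
  {morph f : x y / x ^ y}.
Proof. by move=> x y; rewrite /conjg !gmulfM homV. Qed.

Lemma homR (G1 G2 : groupType) (f : {multiplicative G1 -> G2}) :
  {morph f : x y / [~ x, y]}.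
Proof. by move=> x y; rewrite /commg gmulfM homV homJ. Qed.

(** * Subgroups as sets *)

Lemma subg1 (G : groupType) (H : set G) : is_subgroup H -> H 1.
Proof. by case. Qed.

Lemma subgV (G : groupType) (H : set G) x : is_subgroup H -> H x -> H x^-1.
Proof. by case=> H1 Hd Hx; rewrite -[x^-1]mul1g; exact: Hd. Qed.

Lemma subgM (G : groupType) (H : set G) x y :
  is_subgroup H -> H x -> H y -> H (x * y).
Proof.
move=> sH Hx Hy; rewrite -[y]invgK; case: (sH) => _; apply=> //.
exact: subgV.
Qed.

Lemma subgX (G : groupType) (H : set G) x n :
  is_subgroup H -> H x -> H (x ^+ n).
Proof.
move=> sH Hx; elim: n => [|n IH]; first by rewrite expg0; exact: subg1.
by rewrite expgS; exact: subgM.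
Qed.

Lemma subgJ (G : groupType) (H : set G) x y :
  is_subgroup H -> H x -> H y -> H (x ^ y).
Proof.
by move=> sH Hx Hy; apply: subgM => //; [exact: subgV | exact: subgM].
Qed.

Lemma is_subgroupP (G : groupType) (H : set G) :
  H 1 -> (forall x y, H x -> H y -> H (x * y)) -> (forall x, H x -> H x^-1) ->
  is_subgroup H.
Proof.
by move=> H1 HM HV; split=> // x y Hx Hy; apply: HM => //; exact: HV.
Qed.

Lemma is_subgroup_gen (G : groupType) (A : set G) :
  is_subgroup (subgroup_gen A).
Proof.
split=> [H sH _|x y Ax Ay H sH AH]; first exact: subg1.
by case: (sH) => _; apply; [exact: Ax | exact: Ay].
Qed.

Lemma sub_gen (G : groupType) (A : set G) : A `<=` subgroup_gen A.
Proof. by move=> x Ax H _; apply. Qed.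

Lemma gen_ind (G : groupType) (A : set G) (P : G -> Prop) :
  P 1 -> (forall g a, A a -> P g -> P (g * a)) ->
  (forall g a, A a -> P g -> P (g / a)) -> forall g, subgroup_gen A g -> P g.
Proof.
move=> P1 PM PV g /(_ [set h | forall k, P k -> P (k * h) /\ P (k / h)]) gA.
rewrite -[g]mul1g; apply: (proj1 (gA _ _ 1 P1)) => [|a Aa k Pk]; last first.
  by split; [exact: PM | exact: PV].
apply: is_subgroupP => [k Pk|h h' Ph Ph' k Pk|h Ph k Pk].
- by rewrite invg1 mulg1.
- rewrite invgM !mulgA; split; first by case: (Ph k Pk) => /Ph' [].
  by case: (Ph' k Pk) => _ /Ph [].
- by rewrite invgK; case: (Ph k Pk).
Qed.

Lemma is_subgroup_preimage (G1 G2 : groupType) (f : {multiplicative G1 -> G2})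
    (H : set G2) : is_subgroup H -> is_subgroup (f @^-1` H).
Proof.
move=> sH; split=> [|x y Hx Hy] /=; first by rewrite hom1; exact: subg1.
by rewrite homF; case: sH => _; apply.
Qed.

Lemma is_subgroup_image (G1 G2 : groupType) (f : {multiplicative G1 -> G2})
    (H : set G1) : is_subgroup H -> is_subgroup (f @` H).
Proof.
move=> sH; split=> [|_ _ [x Hx <-] [y Hy <-]] /=.
  by exists 1; [exact: subg1 | rewrite hom1].
by exists (x / y); [case: sH => _; apply | rewrite homF].
Qed.

Lemma is_subgroup_trivial (G : groupType) : is_subgroup [set (1 : G)].
Proof. by split=> // x y -> ->; rewrite divg1. Qed.

Lemma is_subgroup_eq_on (G1 G2 : groupType) (f g : {multiplicative G1 -> G2}) :
  is_subgroup [set x | f x = g x].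
Proof. by split=> [|x y fx fy] /=; rewrite ?hom1 // !homF fx fy. Qed.

Lemma is_subgroup_setT (G : groupType) : is_subgroup [set: G].
Proof. by []. Qed.

Lemma is_subgroup_comm (G : groupType) (A B : set G) :
  is_subgroup (commutator_subgroup A B).
Proof. exact: is_subgroup_gen. Qed.

Lemma mem_comm (G : groupType) (A B : set G) x y :
  A x -> B y -> commutator_subgroup A B [~ x, y].
Proof. by move=> Ax By; apply: sub_gen; exists x, y. Qed.

Lemma mem_derived (G : groupType) (x y : G) : @derived_subgroup G [~ x, y].
Proof. exact: mem_comm. Qed.

Lemma normal_comm (G : groupType) (A B : set G) g :
  (forall a h, A a -> A (a ^ h)) -> (forall b h, B b -> B (b ^ h)) ->
  forall z, commutator_subgroup A B z -> commutator_subgroup A B (z ^ g).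
Proof.
move=> nA nB; have sAB := is_subgroup_comm A B.
have comJ a b h : A a -> B b -> commutator_subgroup A B ([~ a, b] ^ h).
  by move=> Aa Bb; rewrite conjRg; apply: mem_comm; [exact: nA | exact: nB].
apply: (@gen_ind _ _ [set z | commutator_subgroup A B (z ^ g)]).
- by rewrite /= conj1g; exact: subg1.
- move=> h a [x [y [Ax By ->]]] Ph; rewrite /= conjMg.
  by apply: (subgM sAB) => //; exact: comJ.
- move=> h a [x [y [Ax By ->]]] Ph; rewrite /= conjMg conjVg.
  by apply: (subgM sAB) => //; apply: (subgV sAB); exact: comJ.
Qed.

Lemma derivedJ (G : groupType) (a g : G) :
  @derived_subgroup G a -> @derived_subgroup G (a ^ g).
Proof. by apply: normal_comm. Qed.

Lemma is_subgroup_derived (G : groupType) : is_subgroup (@derived_subgroup G).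
Proof. exact: is_subgroup_comm. Qed.

Lemma derived_image (G1 G2 : groupType) (f : {multiplicative G1 -> G2}) a :
  @derived_subgroup G1 a -> @derived_subgroup G2 (f a).
Proof.
move=> /(_ (f @^-1` @derived_subgroup G2)); apply.
  exact: is_subgroup_preimage (@is_subgroup_derived G2).
by move=> _ [x [y [_ _ ->]]] /=; rewrite homR; exact: mem_derived.
Qed.

(** * Affine maps of the rational line *)

(** The pair (m, s) stands for the map that sends t to m t + s, and a product is
    the composite that applies its right factor first. *)
Definition affine := {p : rat * rat | (0 < p.1)%R}.

HB.instance Definition _ := Choice.on affine.

Definition slope (u : affine) : rat := (val u).1.

Definition shift (u : affine) : rat := (val u).2.

Lemma slope_gt0 u : (0 < slope u)%R.
Proof. exact: (valP u). Qed.

Definition mk_affine (m s : rat) (m_gt0 : (0 < m)%R) : affine :=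
  exist (fun p : rat * rat => (0 < p.1)%R) (m, s) m_gt0.

Lemma affine_inj u v : slope u = slope v -> shift u = shift v -> u = v.
Proof.
by case: u v => [[m s] ?] [[m' s'] ?]; rewrite /slope /shift /= => ? ?;
   apply: val_inj => /=; congr pair.
Qed.

Definition affine_one : affine := mk_affine 0%R ltr01.

Definition affine_mul (u v : affine) : affine :=
  mk_affine (shift u + slope u * shift v)%R
    (mulr_gt0 (slope_gt0 u) (slope_gt0 v)).

Lemma affine_inv_gt0 u : (0 < (slope u)^-1)%R.
Proof. by rewrite invr_gt0 slope_gt0. Qed.

Definition affine_inv (u : affine) : affine :=
  mk_affine (- ((slope u)^-1 * shift u))%R (affine_inv_gt0 u).

Lemma affine_opE :
   (forall u v, (slope (affine_mul u v) = slope u * slope v)%R) *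
  (forall u v, (shift (affine_mul u v) = shift u + slope u * shift v)%R) *
  (forall u, (slope (affine_inv u) = (slope u)^-1)%R) *
  (forall u, (shift (affine_inv u) = - ((slope u)^-1 * shift u))%R) *
  (slope affine_one = 1%R) * (shift affine_one = 0%R).
Proof. by []. Qed.

Lemma affine_mulA : associative affine_mul.
Proof. by move=> u v w; apply: affine_inj; rewrite !affine_opE; ring. Qed.

Lemma affine_mul1g : left_id affine_one affine_mul.
Proof. by move=> u; apply: affine_inj; rewrite !affine_opE; ring. Qed.

Lemma affine_mulg1 : right_id affine_one affine_mul.
Proof. by move=> u; apply: affine_inj; rewrite !affine_opE; ring. Qed.

Lemma affine_mulVg : left_inverse affine_one affine_inv affine_mul.
Proof.
move=> u; have u_neq0 := lt0r_neq0 (slope_gt0 u).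
by apply: affine_inj; rewrite !affine_opE; field.
Qed.

Lemma affine_mulgV : right_inverse affine_one affine_inv affine_mul.
Proof.
move=> u; have u_neq0 := lt0r_neq0 (slope_gt0 u).
by apply: affine_inj; rewrite !affine_opE; field.
Qed.

HB.instance Definition _ := isGroup.Build affine affine_mulA affine_mul1g
  affine_mulg1 affine_mulVg affine_mulgV.

Lemma slope1 : slope 1 = 1%R. Proof. by []. Qed.

Lemma shift1 : shift 1 = 0%R. Proof. by []. Qed.

Lemma slopeM (u v : affine) : slope (u * v) = (slope u * slope v)%R.
Proof. by []. Qed.

Lemma shiftM (u v : affine) : shift (u * v) = (shift u + slope u * shift v)%R.
Proof. by []. Qed.

Lemma slopeV (u : affine) : slope u^-1 = (slope u)^-1%R.
Proof. by []. Qed.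

Lemma shiftV (u : affine) : shift u^-1 = (- ((slope u)^-1 * shift u))%R.
Proof. by []. Qed.

Definition affineE :=
  (slopeM, shiftM, slopeV, shiftV, slope1, shift1).

Lemma slopeX (u : affine) n : slope (u ^+ n) = (slope u ^+ n)%R.
Proof. by elim: n => [|n IH] //; rewrite expgS slopeM IH exprS. Qed.

Lemma shiftX (u : affine) n :
  shift (u ^+ n) = (shift u * \sum_(i < n) slope u ^+ i)%R.
Proof.
elim: n => [|n IH]; first by rewrite big_ord0 mulr0.
by rewrite expgSr shiftM IH slopeX big_ord_recr /=; ring.
Qed.

Lemma slope_sum_gt0 (u : affine) n :
  (0 < n)%N -> (0 < \sum_(i < n) slope u ^+ i)%R.
Proof.
case: n => // n _; rewrite big_ord_recl expr0.
apply: (@lt_le_trans _ _ 1%R) => //; rewrite lerDl sumr_ge0 // => i _.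
exact/exprn_ge0/ltW/slope_gt0.
Qed.

(** Positivity of the slope makes roots unique: the slope of u is the positive
    root of the slope of its power, and the shift is then multiplied by a
    positive geometric sum. *)
Lemma affine_root_uniq (u v : affine) n :
  (0 < n)%N -> u ^+ n = v ^+ n -> u = v.
Proof.
move=> n_gt0 uv; have slope_eq : slope u = slope v.
  apply/eqP; rewrite -(@eqrXn2 _ n) ?(ltW (slope_gt0 _)) //.
  by rewrite -!slopeX uv.
apply: affine_inj => //; move: (congr1 shift uv); rewrite !shiftX slope_eq.
by apply: mulIf; rewrite lt0r_neq0 // slope_sum_gt0.
Qed.

Lemma affine_root_fix0 (u : affine) n :
  (0 < n)%N -> shift (u ^+ n) = 0%R -> shift u = 0%R.
Proof.
move=> n_gt0 /eqP; rewrite shiftX mulf_eq0 => /orP [/eqP //|].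
by rewrite gt_eqF // slope_sum_gt0.
Qed.

Definition metabelian (G : groupType) : Prop :=
  forall a b : G, @derived_subgroup G a -> @derived_subgroup G b -> commute a b.

Lemma slope_commg (u v : affine) : slope [~ u, v] = 1%R.
Proof.
rewrite /commg /conjg !affineE.
have := lt0r_neq0 (slope_gt0 u); have := lt0r_neq0 (slope_gt0 v) => v0 u0.
by field; rewrite u0 v0.
Qed.

Lemma slope_derived u : @derived_subgroup affine u -> slope u = 1%R.
Proof.
move=> /(_ [set v | slope v = 1%R]); apply; last first.
  by move=> _ [v [w [_ _ ->]]]; exact: slope_commg.
by split=> // v w /= v1 w1; rewrite !affineE v1 w1 invr1 mulr1.
Qed.

Lemma affine_metabelian : metabelian affine.
Proof.
move=> u v /slope_derived u1 /slope_derived v1; apply: affine_inj.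
  by rewrite !affineE mulrC.
by rewrite !affineE u1 v1; ring.
Qed.

(** * Bases of free metabelian groups *)

(** The universal property of a free group only speaks of group types, so that
    a generated subgroup has to be made into one. *)
Definition gen_type (G : groupType) (A : set G) :=
  {x : G | `[< subgroup_gen A x >]}.

HB.instance Definition _ (G : groupType) (A : set G) :=
  [isSub of gen_type A for @sval G (fun x => `[< subgroup_gen A x >])].

HB.instance Definition _ (G : groupType) (A : set G) :=
  [Choice of gen_type A by <:].

Lemma gen_group_closed (G : groupType) (A : set G) :
  group_closed [pred x | `[< subgroup_gen A x >]].
Proof.
have sA := is_subgroup_gen A; split=> [|x y]; rewrite !inE.
  exact: (subg1 sA).
by move=> Ax Ay; case: sA => _; apply.
Qed.

HB.instance Definition _ (G : groupType) (A : set G) :=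
  SubChoice_isSubGroup.Build G _ (gen_type A) (gen_group_closed A).

(** The identity and the retraction onto the subgroup generated by the basis
    agree on the basis, so they are equal. *)
Lemma free_generated (F : groupType) (X : Type) (i : X -> F) :
  is_free_on i -> subgroup_gen (range i) = [set: F].
Proof.
move=> freeF; apply/seteqP; split=> // y _.
have iP x : `[< subgroup_gen (range i) (i x) >].
  by apply/asboolP; apply: sub_gen; exists x.
pose j x : gen_type (range i) := Sub (i x) (iP x).
have [[h hE] _] := freeF _ j.
pose v : {multiplicative gen_type (range i) -> F} := val.
have [_ /(_ idfun (v \o h) _ _ y)] := freeF F i.
have agree x : (v \o h) (i x) = i x by rewrite /= hE.
by move=> /(_ (fun=> erefl) agree) /= ->; apply/asboolP; exact: (valP (h y)).
Qed.

Definition metabelian_basis (G : groupType) (Z : set G) : Prop :=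
  [/\ subgroup_gen Z = [set: G], metabelian G &
      forall (M : groupType) (f : G -> M), metabelian M ->
        exists h : {multiplicative G -> M}, forall z, Z z -> h z = f z].

Lemma quotient_lift (F G M : groupType) (p : {multiplicative F -> G})
    (h : {multiplicative F -> M}) :
  range p = [set: G] -> (forall x, p x = 1 -> h x = 1) ->
  exists k : {multiplicative G -> M}, forall x, k (p x) = h x.
Proof.
move=> p_surj ker_p.
have /choice [s sK] g : exists x, p x = g.
  by have : range p g by [rewrite p_surj]; case=> x _ <-; exists x.
have eq_h x y : p x = p y -> h x = h y.
  by move=> pxy; apply/divg1_eq; rewrite -homF ker_p // homF pxy mulgV.
have kM : {morph h \o s : a b / a * b}.
  by move=> a b /=; rewrite -gmulfM; apply: eq_h; rewrite gmulfM !sK.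
pose kS := isMultiplicative.Build G M (h \o s) kM.
pose k : {multiplicative G -> M} := HB.pack (h \o s) kS.
by exists k => x; apply: eq_h; rewrite sK.
Qed.

Lemma free_metabelian_basis (G : groupType) :
  is_free_metabelian G -> exists Z : set G, metabelian_basis Z.
Proof.
case=> F [p [[X [i freeF]] p_surj ker_p]].
have genF := free_generated freeF.
have surj g : exists x, p x = g.
  by have : range p g by [rewrite p_surj]; case=> x _ <-; exists x.
have derived_lift a : @derived_subgroup G a ->
    exists2 x, @derived_subgroup F x & p x = a.
  move=> /(_ (p @` @derived_subgroup F)) [||x Fx <-]; last by exists x.
    exact: is_subgroup_image (@is_subgroup_derived F).
  move=> _ [b [c [_ _ ->]]]; have [x <-] := surj b; have [y <-] := surj c.
  by exists [~ x, y]; [exact: mem_derived | rewrite homR].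
exists (range (p \o i)); split.
- apply/seteqP; split=> // g _; have [x <-] := surj g.
  have : subgroup_gen (range i) x by rewrite genF.
  move=> /(_ (p @^-1` subgroup_gen (range (p \o i)))); apply.
    exact: is_subgroup_preimage (is_subgroup_gen _).
  by move=> _ [t _ <-]; apply: sub_gen; exists t.
- move=> _ _ /derived_lift [x Fx <-] /derived_lift [y Fy <-].
  apply/commgP/eqP; rewrite -homR.
  have : (p @^-1` [set 1]) [~ x, y] by rewrite ker_p; exact: mem_comm.
  by move=> /= ->.
- move=> M f metM; have [[h hE] _] := freeF M (f \o p \o i).
  have [k kE] : exists k : {multiplicative G -> M}, forall x, k (p x) = h x.
    apply: quotient_lift => // x px1.
    have : second_derived_subgroup x by rewrite -ker_p.
    move=> /(_ (h @^-1` [set 1])); apply.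
      exact: is_subgroup_preimage (is_subgroup_trivial M).
    move=> _ [a [b [Fa Fb ->]]] /=; rewrite homR; apply/eqP/commgP.
    by apply: metM; exact: derived_image.
  by exists k => _ [x _ <-] /=; rewrite kE hE.
Qed.

Lemma noncyclic_basis (G : groupType) (Z : set G) :
  metabelian_basis Z -> ~ is_cyclic G -> exists x y, [/\ Z x, Z y & x <> y].
Proof.
case=> genZ _ _ ncyc; apply: contrapT => no_pair; apply: ncyc.
have [[x Zx]|Z0] := pselect (exists x, Z x); last first.
  exists 1; apply/seteqP; split=> // g _.
  have : subgroup_gen Z g by rewrite genZ.
  apply; first exact: is_subgroup_gen.
  by move=> z Zz; case: Z0; exists z.
exists x; rewrite -genZ; congr subgroup_gen; apply/seteqP; split=> [_ -> //|y Zy].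
by apply: contrapT => /= yx; apply: no_pair; exists y, x.
Qed.

(** * Signed products and independence of characters *)

Definition signed_prod (G : groupType) (E : Type) (v : E -> G)
    (s : seq (E * bool)) : G :=
  \prod_(p <- s) (if p.2 then (v p.1)^-1 else v p.1).

Definition signed_count (E : eqType) (s : seq (E * bool)) (e : E) : int :=
  (\sum_(p <- s) (-1) ^+ p.2 *+ (p.1 == e))%R.

Lemma signed_prod_cat (G : groupType) (E : Type) (v : E -> G) s1 s2 :
  signed_prod v (s1 ++ s2) = signed_prod v s1 * signed_prod v s2.
Proof. exact: big_cat. Qed.

Lemma signed_prod_cons (G : groupType) (E : Type) (v : E -> G) p s :
  signed_prod v (p :: s) = (if p.2 then (v p.1)^-1 else v p.1) * signed_prod v s.
Proof. exact: big_cons. Qed.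

Lemma signed_prod_subg (G : groupType) (H : set G) (E : Type) (v : E -> G) s :
  is_subgroup H -> (forall e, H (v e)) -> H (signed_prod v s).
Proof.
move=> sH Hv; elim: s => [|[e b] s IH].
  by rewrite /signed_prod big_nil; exact: (subg1 sH).
rewrite signed_prod_cons; apply: (subgM sH) => //=.
by case: b => //; exact: (subgV sH).
Qed.

Lemma hom_signed_prod (G1 G2 : groupType) (f : {multiplicative G1 -> G2})
    (E : Type) (v : E -> G1) s :
  f (signed_prod v s) = signed_prod (f \o v) s.
Proof.
elim: s => [|[e b] s IH]; first by rewrite /signed_prod !big_nil hom1.
by rewrite !signed_prod_cons gmulfM IH /=; case: b; rewrite ?homV.
Qed.

Lemma signed_count_cons (E : eqType) (p : E * bool) s e :
  signed_count (p :: s) e = ((-1) ^+ p.2 *+ (p.1 == e) + signed_count s e)%R.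
Proof. exact: big_cons. Qed.

Lemma signed_count_cat (E : eqType) (s1 s2 : seq (E * bool)) e :
  signed_count (s1 ++ s2) e = (signed_count s1 e + signed_count s2 e)%R.
Proof. exact: big_cat. Qed.

Lemma signed_count_one_sign (E : eqType) (s : seq (E * bool)) e b :
  (e, ~~ b) \notin s ->
  signed_count s e = ((-1) ^+ b *+ count_mem (e, b) s)%R.
Proof.
elim: s => [|[e' b'] s IH]; first by rewrite /signed_count big_nil.
rewrite inE negb_or => /andP [neq /IH]; rewrite signed_count_cons /= => ->.
rewrite mulrnDr; congr (_ + _)%R; move: neq; rewrite !xpair_eqE [e == e']eq_sym.
by case: eqP => //= _; case: b {IH} b' => [] [].
Qed.

Lemma is_subgroup_commute_mod (G : groupType) (N : set G) g :
  is_subgroup N -> (forall n h, N n -> N (n ^ h)) ->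
  is_subgroup [set h | N [~ g, h]].
Proof.
move=> sN nN; apply: is_subgroupP => [|h k Nh Nk|h Nh] /=.
- by rewrite commg1; exact: (subg1 sN).
- have -> : [~ g, h * k] = [~ g, k] * [~ g, h] ^ k.
    by group_normalize.
  by apply: (subgM sN) => //; exact: nN.
- have -> : [~ g, h^-1] = ([~ g, h]^-1) ^ h^-1.
    by group_normalize.
  by apply: nN; exact: (subgV sN).
Qed.

(** Modulo N the values of v commute, so each factor can be moved next to a
    factor with the same index and the opposite sign. *)
Lemma signed_prod_cancel (G : groupType) (N : set G) (E : eqType) (v : E -> G) s :
  is_subgroup N -> (forall n g, N n -> N (n ^ g)) ->
  (forall e e', N [~ v e, v e']) ->
  (forall e, signed_count s e = 0%R) -> N (signed_prod v s).
Proof.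
move=> sN nN vN; have [n] := ubnP (size s); elim: n s => // n IH [_ _|].
  by rewrite /signed_prod big_nil; exact: (subg1 sN).
case=> e b s /=; rewrite ltnS => size_s count0.
have opp_in : (e, ~~ b) \in s.
  apply: contraT => /signed_count_one_sign count_s; move: (count0 e).
  rewrite signed_count_cons /= eqxx count_s -mulrnDr => /eqP.
  by rewrite mulrn_eq0 signr_eq0.
move: size_s count0; case/splitPr: opp_in => s1 s2 size_s count0.
have count12 e' : signed_count (s1 ++ s2) e' = 0%R.
  rewrite -(count0 e') signed_count_cons !signed_count_cat signed_count_cons /=.
  by case: eqP => _; case: b {count0 size_s}; rewrite /= ?mulr1n ?mulr0n; ring.
have {}IH : N (signed_prod v (s1 ++ s2)).
  apply: IH => //; move: size_s; rewrite !size_cat /= addnS; exact: ltnW.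
have s1e : N [~ signed_prod v s1, v e].
  rewrite -invgR; apply: (subgV sN).
  exact: signed_prod_subg (is_subgroup_commute_mod _ sN nN) (vN e).
have s1eV : N [~ signed_prod v s1, (v e)^-1].
  exact: (subgV (is_subgroup_commute_mod _ sN nN)) s1e.
have move_e (u : G) : N [~ signed_prod v s1, u^-1] ->
    N (u * (signed_prod v s1 * (u^-1 * signed_prod v s2))).
  move=> Nu; rewrite signed_prod_cat in IH.
  have -> : u * (signed_prod v s1 * (u^-1 * signed_prod v s2)) =
      signed_prod v s1 * signed_prod v s2 *
        [~ signed_prod v s1, u^-1] ^ signed_prod v s2.
    by group_normalize.
  by apply: (subgM sN) => //; exact: nN.
rewrite signed_prod_cons signed_prod_cat signed_prod_cons /=.
by case: b {count0 size_s IH} => /=; [rewrite -{2}[v e]invgK|]; apply: move_e;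
  rewrite ?invgK.
Qed.

(** Dedekind: multiply the relation at d by the value of one character at d' and
    subtract it from the relation at the product of d and d'; the result is a
    shorter relation. *)
Lemma characters_independent (D : Type) (E : eqType) (K : fieldType)
    (chi : E -> D -> K) (d0 : D) (u : seq E) (c : E -> K) :
  (forall d d', exists d'', forall e, chi e d'' = chi e d * chi e d')%R ->
  (forall e d, chi e d != 0%R) ->
  {in u &, forall e e', (forall d, chi e d = chi e' d) -> e = e'} ->
  uniq u -> (forall d, \sum_(e <- u) c e * chi e d = 0)%R ->
  {in u, forall e, c e = 0%R}.
Proof.
move=> chiM chi_neq0; elim: u c => // e0 u IH c chi_inj /= /andP [e0u uniq_u] rel.
have relM d d' : (\sum_(e <- u) c e * (chi e d' - chi e0 d') * chi e d = 0)%R.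
  have [d'' d''E] := chiM d d'.
  transitivity (\sum_(e <- e0 :: u) c e * chi e d'' -
                chi e0 d' * \sum_(e <- e0 :: u) c e * chi e d)%R; last first.
    by rewrite !rel mulr0 subr0.
  rewrite mulr_sumr -sumrB big_cons d''E.
  rewrite [X in (_ = X + _)%R](_ : _ = 0)%R ?add0r; last by ring.
  by apply: eq_bigr => e _; rewrite d''E; ring.
have c0 : {in u, forall e, c e = 0%R}.
  move=> e eu; apply: contrapT => /eqP ce; move: e0u.
  rewrite (chi_inj e0 e) ?inE ?eqxx ?eu ?orbT // => d'; apply/eqP.
  have chi_inj_u :
      {in u &, forall e1 e2, (forall d, chi e1 d = chi e2 d) -> e1 = e2}.
    by move=> e1 e2 e1u e2u; apply: chi_inj; rewrite inE ?e1u ?e2u orbT.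
  have /eqP := IH (fun e => c e * (chi e d' - chi e0 d'))%R chi_inj_u uniq_u
    (relM^~ d') e eu.
  by rewrite mulf_eq0 (negPf ce) subr_eq0 eq_sym.
move=> e; rewrite inE => /orP [/eqP ->|]; last exact: c0.
apply/eqP; move: (rel d0); rewrite big_cons big1_seq ?addr0.
  by move/eqP; rewrite mulf_eq0 (negPf (chi_neq0 _ _)) orbF.
by move=> e' /= /c0 ->; rewrite mul0r.
Qed.

(** * Free metabelian groups are residually affine *)

Lemma affine_hom (G : groupType) (Z : set G) (m s : G -> rat) :
  metabelian_basis Z -> (forall z, 0 < m z)%R ->
  exists psi : {multiplicative G -> affine},
    forall z, Z z -> slope (psi z) = m z /\ shift (psi z) = s z.
Proof.
case=> _ _ univ m_gt0.
have [psi psiE] := univ _ (fun z => mk_affine (s z) (m_gt0 z)) affine_metabelian.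
by exists psi => z /psiE ->.
Qed.

Lemma eq_slope (G : groupType) (Z : set G)
    (psi1 psi2 : {multiplicative G -> affine}) :
  metabelian_basis Z -> (forall z, Z z -> slope (psi1 z) = slope (psi2 z)) ->
  forall g, slope (psi1 g) = slope (psi2 g).
Proof.
case=> genZ _ _ eqZ g; have : subgroup_gen Z g by rewrite genZ.
move=> /(_ [set g | slope (psi1 g) = slope (psi2 g)]); apply=> //.
split=> [|x y xE yE] /=; first by rewrite !hom1.
by rewrite !homF !affineE xE yE.
Qed.

Lemma slope_hom_derived (G : groupType) (psi : {multiplicative G -> affine}) a :
  @derived_subgroup G a -> slope (psi a) = 1%R.
Proof. by move=> /(derived_image psi); exact: slope_derived. Qed.

Lemma derived_rep (G : groupType) : exists rep : G -> G,
  (forall g, @derived_subgroup G (g / rep g)) /\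
  (forall g h, @derived_subgroup G (g / h) -> rep g = rep h).
Proof.
have sA := @is_subgroup_derived G.
exists (fun g => xget 1 [set h | @derived_subgroup G (g / h)]); split=> [g|g h gh].
  have /(_ (ex_intro _ g _)) := @xgetPex G 1 [set h | @derived_subgroup G (g / h)].
  by apply=> /=; rewrite mulgV; exact: (subg1 sA).
congr xget; apply/seteqP; split=> k /= Ak.
  have -> : h / k = (g / h)^-1 * (g / k) by group_normalize.
  by apply: (subgM sA) => //; exact: (subgV sA).
have -> : g / k = (g / h) * (h / k) by group_normalize.
exact: (subgM sA).
Qed.

(** The edge of the Cayley graph of G modulo its derived subgroup that starts at
    the vertex represented by q and has label z, read in G along the chosen
    representatives of the vertices. *)
Definition edge (G : groupType) (rep : G -> G) (e : G * G) : G :=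
  e.1 * e.2 / rep (e.1 * e.2).

(** The list s is the path of a word for g in the Cayley graph, with the sign true
    for an edge that is crossed backwards. Along it the product of the edges
    telescopes, and the shift of an affine image of g becomes a signed sum over
    the edges: this is the Magnus embedding. *)
Lemma edge_path (G : groupType) (Z : set G) (rep : G -> G) (g : G) :
  subgroup_gen Z = [set: G] ->
  (forall g, @derived_subgroup G (g / rep g)) ->
  (forall g h, @derived_subgroup G (g / h) -> rep g = rep h) ->
  exists s : seq (G * G * bool),
    [/\ forall p, p \in s -> rep p.1.1 = p.1.1 /\ Z p.1.2,
        signed_prod snd s = g,
        signed_prod (edge rep) s = rep 1 * g / rep g &
        forall psi : {multiplicative G -> affine},
          shift (psi g) = (\sum_(p <- s)
            (-1) ^+ p.2 * slope (psi p.1.1) * shift (psi p.1.2))%R].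
Proof.
move=> genZ Arep repA; have sA := @is_subgroup_derived G.
have AV h k : @derived_subgroup G (h / k) -> @derived_subgroup G (k / h).
  by move=> /(subgV sA); rewrite invgF.
have rep_rep h : rep (rep h) = rep h by apply: repA; exact: AV (Arep _).
have repM h z : rep (rep h * z) = rep (h * z).
  by apply: repA; rewrite mulgKA; exact: AV (Arep _).
have slope_rep (psi : {multiplicative G -> affine}) h :
    slope (psi (rep h)) = slope (psi h).
  have := slope_hom_derived psi (Arep h); rewrite homF !affineE.
  by move=> /divr1_eq.
have : subgroup_gen Z g by rewrite genZ.
move: g; apply: gen_ind => [|g z Zz|g z Zz].
- exists [::]; split=> [p||| psi] //; rewrite /signed_prod ?big_nil ?mulg1 ?mulgV //.
  by rewrite hom1.
- case=> s [sP sg s_edge s_shift]; exists (rcons s (rep g, z, false)); split.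
  + by move=> p; rewrite mem_rcons inE => /orP [/eqP -> /=|/sP //]; split.
  + by rewrite -cats1 signed_prod_cat sg /signed_prod big_seq1.
  + rewrite -cats1 signed_prod_cat s_edge /signed_prod big_seq1 /edge /= repM.
    by group_normalize.
  + move=> psi; rewrite -cats1 big_cat big_seq1 -s_shift /= slope_rep.
    by rewrite expr0 mul1r gmulfM affineE.
- case=> s [sP sg s_edge s_shift]; exists (rcons s (rep (g / z), z, true)); split.
  + by move=> p; rewrite mem_rcons inE => /orP [/eqP -> /=|/sP //]; split.
  + by rewrite -cats1 signed_prod_cat sg /signed_prod big_seq1.
  + rewrite -cats1 signed_prod_cat s_edge /signed_prod big_seq1 /edge /= repM.
    by rewrite mulgVK; group_normalize.
  + move=> psi; rewrite -cats1 big_cat big_seq1 -s_shift /= slope_rep.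
    by rewrite homF !affineE /=; ring.
Qed.

Lemma slope_signed_prod (E : eqType) (v : E -> affine) (e0 : E) s :
  (forall e, slope (v e) = if e == e0 then 2%:R else 1)%R ->
  slope (signed_prod v s) = (2%:R ^ signed_count s e0)%R.
Proof.
move=> vE; elim: s => [|[e b] s IH].
  by rewrite /signed_prod /signed_count !big_nil.
rewrite signed_prod_cons signed_count_cons slopeM IH exprzDr ?unitfE //.
congr (_ * _)%R; rewrite /=; case: b; rewrite ?affineE vE.
  by case: eqP; rewrite /= ?mulr1n ?mulr0n ?invr1.
by case: eqP; rewrite /= ?mulr1n ?mulr0n.
Qed.

(** The exponent sum of a basis element in g is seen by the homomorphism that
    maps this element to the dilation by 2 and the rest of the basis to 1. *)
Lemma derived_of_slopes (G : groupType) (Z : set G) (g : G) :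
  metabelian_basis Z ->
  (forall psi : {multiplicative G -> affine}, slope (psi g) = 1%R) ->
  @derived_subgroup G g.
Proof.
move=> basisZ slope1; have [genZ _ _] := basisZ; have sA := @is_subgroup_derived G.
have [rep [Arep repA]] := derived_rep G.
have [s [sP sg _ _]] := edge_path g genZ Arep repA.
pose s' := [seq (p.1.2, p.2) | p <- s].
have s'g : signed_prod id s' = g by rewrite -sg /signed_prod big_map.
rewrite -s'g; apply: signed_prod_cancel => //.
- by move=> n h; exact: derivedJ.
- by move=> e e'; exact: mem_derived.
move=> z0; have m_gt0 z : (0 < if z == z0 then 2%:R else 1 : rat)%R by case: eqP.
have [psi psiE] := affine_hom (fun=> 0%R) basisZ m_gt0.
have := slope1 psi; rewrite -sg hom_signed_prod.
pose v z := mk_affine 0%R (m_gt0 z).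
have -> : signed_prod (psi \o snd) s = signed_prod v s'.
  rewrite /signed_prod big_map; apply: eq_big_seq => p /sP [_ Zp] /=.
  have -> // : psi p.1.2 = v p.1.2.
  by have [? ?] := psiE _ Zp; apply: affine_inj.
rewrite (@slope_signed_prod _ v z0) // => /eqP.
by rewrite pexprz_eq1 // orbF => /eqP.
Qed.

Lemma intr_signed_count (E : eqType) (s : seq (E * bool)) e :
  ((signed_count s e)%:~R = \sum_(p <- s) (-1) ^+ p.2 *+ (p.1 == e) :> rat)%R.
Proof.
elim: s => [|[e' b] s IH]; first by rewrite /signed_count !big_nil.
rewrite signed_count_cons big_cons intrD IH; congr (_ + _)%R.
by case: b (e' == e) => [] [].
Qed.

(** If all affine images of g are trivial, then g lies in the derived subgroup,
    and independence of the slope characters shows that its path crosses every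
    edge as often forwards as backwards. *)
Lemma residually_affine (G : groupType) (Z : set G) (g : G) :
  metabelian_basis Z ->
  (forall psi : {multiplicative G -> affine}, psi g = 1) -> g = 1.
Proof.
move=> basisZ psi1; have [genZ metG _] := basisZ.
have sA := @is_subgroup_derived G.
have Ag : @derived_subgroup G g.
  by apply: (derived_of_slopes basisZ) => psi; rewrite psi1.
have [rep [Arep repA]] := derived_rep G.
have [s [sP _ s_edge s_shift]] := edge_path g genZ Arep repA.
suff : signed_prod (edge rep) s = 1.
  rewrite s_edge (repA g 1) ?divg1 //.
  have -> : rep 1 * g / rep 1 = g ^ (rep 1)^-1 by group_normalize.
  by move/eqP; rewrite conjg_eq1 => /eqP.
apply: (@signed_prod_cancel _ [set 1]) => [||e e'|].
- exact: is_subgroup_trivial.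
- by move=> n h /= ->; rewrite conj1g.
- by apply/eqP/commgP; apply: metG; exact: Arep.
case=> q0 z0; pose u := undup [seq p.1.1 | p <- s].
have [q0u|q0u] := boolP (q0 \in u); last first.
  apply: big1_seq => p /andP [_ ps]; case: eqP => // pE.
  by move: q0u; rewrite mem_undup => /mapP []; exists p => //; rewrite pE.
pose D := {multiplicative G -> affine}.
pose chi (q : G) (psi : D) := slope (psi q).
apply/eqP; rewrite -(intr_eq0 rat); apply/eqP.
have [d0 _] := affine_hom (fun=> 0%R) basisZ (fun=> ltr01).
apply: (@characters_independent D _ rat chi d0 u
         (fun q => (signed_count s (q, z0))%:~R)%R) => //.
- move=> d d'; have m_gt0 z : (0 < slope (d z) * slope (d' z))%R.
    by rewrite mulr_gt0 ?slope_gt0.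
  have [d'' d''E] := affine_hom (fun=> 0%R) basisZ m_gt0.
  exists d'' => q; have : subgroup_gen Z q by rewrite genZ.
  move=> /(_ [set q | chi q d'' = chi q d * chi q d']%R); apply.
    split=> [|x y]; rewrite /chi /=; first by rewrite !hom1 mulr1.
    by rewrite !homF !affineE => -> ->; rewrite invfM; ring.
  by move=> z /d''E [].
- by move=> q psi; rewrite lt0r_neq0 ?slope_gt0.
- move=> q q'; rewrite !mem_undup => /mapP [p ps ->] /mapP [p' ps' ->] eq_chi.
  have [<- _] := sP _ ps; have [<- _] := sP _ ps'; apply: repA.
  apply: (derived_of_slopes basisZ) => psi; rewrite homF !affineE.
  by have := eq_chi psi; rewrite /chi => ->; rewrite mulfV ?lt0r_neq0 ?slope_gt0.
- exact: undup_uniq.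
(* With the slopes of psi and a nonzero shift only at z0, the shift of g is the
   relation between the slope characters. *)
move=> psi; have m_gt0 z := slope_gt0 (psi z).
have [psi' psi'E] := affine_hom (fun z => (z == z0)%:R)%R basisZ m_gt0.
have eq_slope_psi :=
  @eq_slope _ _ psi' psi basisZ (fun z Zz => proj1 (psi'E z Zz)).
have := s_shift psi'; rewrite psi1 shift1 => /esym.
move=> sum0; rewrite -[RHS]sum0 /chi.
under eq_bigr do rewrite intr_signed_count mulr_suml.
rewrite exchange_big /=; apply: eq_big_seq => p ps.
have [_ Zp] := sP _ ps; rewrite eq_slope_psi (proj2 (psi'E _ Zp)).
have pu : p.1.1 \in u by rewrite mem_undup; apply/mapP; exists p.
rewrite (bigD1_seq p.1.1) ?undup_uniq //= big1 => [|q /negPf q_neq].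
  rewrite addr0 [p.1]surjective_pairing xpair_eqE eqxx /=.
  by rewrite -[in RHS]mulr_natr; ring.
by rewrite [p.1]surjective_pairing xpair_eqE eq_sym q_neq /= mulr0n mul0r.
Qed.

Lemma root_uniq (G : groupType) (Z : set G) (g h : G) n :
  metabelian_basis Z -> (0 < n)%N -> g ^+ n = h ^+ n -> g = h.
Proof.
move=> basisZ n_gt0 gh; apply/divg1_eq/(residually_affine basisZ) => psi.
rewrite homF (_ : psi g = psi h) ?mulgV //.
by apply: (affine_root_uniq n_gt0); rewrite -!homX gh.
Qed.

(** * Subgroups invisible to nilpotent quotients *)

Lemma is_subgroup_lcs (G : groupType) n :
  is_subgroup (@lower_central_series G n).
Proof.
by case: n => [|n]; [exact: is_subgroup_setT | exact: is_subgroup_comm].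
Qed.

Lemma lcsJ (G : groupType) n (u g : G) :
  lower_central_series n u -> lower_central_series n (u ^ g).
Proof.
elim: n u g => // n IH u g; apply: normal_comm => // a h; exact: IH.
Qed.

(** Put r = y ^ x / y / y. In the relation y = r^-1 (y ^ x) y^-1 an approximation
    of y by an element of L modulo one term of the lower central series improves
    to an approximation modulo the next term. *)
Lemma nilpotent_mem (N : groupType) (L : set N) x y :
  is_nilpotent N -> is_subgroup L -> L x -> L (y ^ x / y / y) -> L y.
Proof.
case=> n lcs_n sL Lx Lr.
suff /(_ n) [l Ll] : forall k, exists2 l, L l & lower_central_series k (l^-1 * y).
  by rewrite lcs_n => /mulg1_eq <-; rewrite invgK.
elim=> [|k [l Ll yl]]; first by exists 1; first exact: (subg1 sL).
pose l' := (y ^ x / y / y)^-1 * (l ^ x / l); exists l'.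
  apply: (subgM sL); first exact: (subgV sL).
  by apply: (subgM sL); [exact: (subgJ sL) | exact: (subgV sL)].
have -> : l'^-1 * y = ([~ (l^-1 * y)^-1, x]^-1) ^ l^-1.
  by rewrite /l'; group_normalize.
apply: lcsJ; apply: (subgV (is_subgroup_lcs N k.+1)); apply: mem_comm => //.
exact: (subgV (is_subgroup_lcs N k)).
Qed.

(** * The subgroup *)

Lemma derived_conjC (G : groupType) (a g h : G) :
  metabelian G -> @derived_subgroup G a -> (a ^ g) ^ h = (a ^ h) ^ g.
Proof.
move=> metG Aa; have -> : (a ^ h) ^ g = ((a ^ g) ^ h) ^ [~ h, g].
  by rewrite -!conjgM; congr conjg; group_normalize.
apply/esym/conjg_fixP; apply/commgP; apply: metG; last exact: mem_derived.
by do 2!apply: derivedJ.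
Qed.

Definition bs_comm (G : groupType) (x y : G) : G := y ^ x / y.

(** The second entry is the relator of the Baumslag-Solitar group
    BS(1, 2) = < x, y | y ^ x = y ^ 2 >. With c the commutator, adding the last two
    entries to a subgroup makes x square c and y centralise c modulo it, if the
    group is metabelian: then c / y acts on c as the inverse of y. *)
Definition bs_seq (G : groupType) (x y : G) : seq G :=
  let c := bs_comm x y in
  [:: x; c / y; c ^ x / c / c; c ^ (c / y) / c].

Definition bs_subgroup (G : groupType) (x y : G) : set G :=
  subgroup_gen [set` bs_seq x y].

Lemma cyclicP (G : groupType) (c u : G) :
  subgroup_gen [set c] u -> exists n, u = c ^+ n \/ u = c ^- n.
Proof.
move: u; apply: gen_ind => [|g a -> [n [->|->]]|g a -> [n [->|->]]].
- by exists 0%N; left.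
- by exists n.+1; left; rewrite expgSr.
- case: n => [|n]; first by exists 1%N; left; rewrite invg1 mul1g.
  by exists n; right; rewrite expgS invgM mulgVK.
- case: n => [|n]; first by exists 1%N; right; rewrite mul1g.
  by exists n; left; rewrite expgSr mulgK.
- by exists n.+1; right; rewrite expgS invgM.
Qed.

(** In an affine image where c is the translation by 1 and x the dilation by 1/2,
    such an element d of the derived subgroup is a translation by a dyadic
    rational, with denominator at most 2 ^ n. *)
Definition dyadic (G : groupType) (x y d : G) : Prop :=
  @derived_subgroup G d /\
  exists n u, subgroup_gen [set bs_comm x y] u /\
    bs_subgroup x y (d ^ (x ^+ n) * u).

(** The subgroup contains x, and y is the product of one of its elements and c.
    So it suffices that conjugation by its first two generators and their inverses
    preserves the subgroup of dyadic elements. *)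
Lemma bs_factor (G : groupType) (x y g : G) :
  metabelian G -> subgroup_gen [set z | z = x \/ z = y] g ->
  exists t d, [/\ bs_subgroup x y t, dyadic x y d & g = t * d].
Proof.
move=> metG gK; set c := bs_comm x y; set T := bs_subgroup x y.
have sT : is_subgroup T := is_subgroup_gen _.
have sA := @is_subgroup_derived G.
have sC : is_subgroup (subgroup_gen [set c]) := is_subgroup_gen _.
have T_seq z : z \in bs_seq x y -> T z by move=> zs; exact: sub_gen.
have Tx : T x by apply: T_seq; rewrite inE eqxx.
have Tr : T (c / y) by apply: T_seq; rewrite !inE eqxx orbT.
have Tcx : T (c ^ x / c / c) by apply: T_seq; rewrite !inE eqxx !orbT.
have Tcr : T (c ^ (c / y) / c) by apply: T_seq; rewrite !inE eqxx !orbT.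
have Cc : subgroup_gen [set c] c by apply: sub_gen.
have Ac : @derived_subgroup G c.
  rewrite /c /bs_comm (_ : y ^ x / y = [~ x, y^-1]); first exact: mem_derived.
  by group_normalize.
have CA u : subgroup_gen [set c] u -> @derived_subgroup G u.
  by apply=> // _ ->.
pose I a := @derived_subgroup G a /\ exists2 u, subgroup_gen [set c] u & T (a * u).
have sI : is_subgroup [set a | I a].
  split=> [|a b [Aa [u Cu Tau]] [Ab [v Cv Tbv]]].
    split; first exact: (subg1 sA).
    by exists 1; [exact: (subg1 sC) | rewrite mulg1; exact: (subg1 sT)].
  split; first by case: sA => _; apply.
  exists (u / v); first by case: sC => _; apply.
  have -> : a / b * (u / v) = (a * u) / (b * v); last by case: sT => _; apply.
  have [Au Av] := (CA _ Cu, CA _ Cv).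
  rewrite invgM -!mulgA; congr (a * _); rewrite [u * (_ * _)]mulgA; apply: metG.
    exact: (subgV sA).
  by case: sA => _; apply.
have IJ t : T t -> I (c ^ t) -> forall a, I a -> I (a ^ t).
  move=> Tt Ict a [Aa [u Cu Tau]].
  have -> : a ^ t = (a * u) ^ t / (u ^ t) by rewrite conjMg mulgK.
  case: (sI) => _; apply.
    split; first by apply: derivedJ; apply: (subgM sA) => //; exact: CA.
    exists 1; first exact: (subg1 sC).
    by rewrite mulg1; exact: (subgJ sT).
  have sIt : is_subgroup [set u | I (u ^ t)].
    split=> [|b b' Ib Ib'] /=; first by rewrite conj1g; exact: (subg1 sI).
    by rewrite conjMg conjVg; case: sI => _; apply.
  by apply: (Cu _ sIt) => _ ->.
have I_div a : @derived_subgroup G a -> T (a / c) -> I a.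
  by move=> Aa Ta; split=> //; exists c^-1 => //; exact: (subgV sC).
have Icx : I (c ^ x).
  split; first exact: derivedJ.
  exists (c^-1 * c^-1); last by rewrite mulgA.
  by apply: (subgM sC); exact: (subgV sC).
have Icr : I (c ^ (c / y)) by apply: I_div => //; exact: derivedJ.
have IcrV : I (c ^ (c / y)^-1).
  apply: I_div; first exact: derivedJ.
  have := subgJ sT (subgV sT Tcr) (subgV sT Tr); congr T.
  by rewrite invgF conjMg conjVg conjgK; group_normalize.
pose D d := @derived_subgroup G d /\ exists n, I (d ^ (x ^+ n)).
have D_dyadic d : D d -> dyadic x y d.
  by case=> Ad [n [_ [u Cu Tdu]]]; split=> //; exists n, u.
have I_up d n k : I (d ^ (x ^+ n)) -> I (d ^ (x ^+ (n + k))).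
  move=> Id; elim: k => [|k IH]; first by rewrite addn0.
  by rewrite addnS expgSr conjgM; apply: IJ.
have sD : is_subgroup [set d | D d].
  split=> [|a b [Aa [n Ia]] [Ab [k Ib]]].
    split; first exact: (subg1 sA).
    by exists 0%N; rewrite conj1g; exact: (subg1 sI).
  split; first by case: sA => _; apply.
  exists (n + k); rewrite conjMg conjVg; case: (sI) => _; apply; first exact: I_up.
  by rewrite addnC; exact: I_up.
have Dc : D c.
  split=> //; exists 0%N; rewrite expg0 conjg1; apply: I_div => //.
  by rewrite mulgV; exact: (subg1 sT).
have DJ t d : T t -> (forall a, I a -> I (a ^ t)) -> D d -> D (d ^ t).
  move=> Tt It [Ad [n Id]]; split; first exact: derivedJ.
  by exists n; rewrite derived_conjC //; exact: It.
have DJxV d : D d -> D (d ^ x^-1).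
  move=> [Ad [n Id]]; split; first exact: derivedJ.
  by exists n.+1; rewrite expgS conjgM conjgKV.
have DJx d : D d -> D (d ^ x) by apply: DJ => //; exact: IJ.
have DJr d : D d -> D (d ^ (c / y)) by apply: DJ => //; exact: IJ.
have DJrV d : D d -> D (d ^ (c / y)^-1).
  by apply: DJ; [exact: (subgV sT) | apply: IJ => //; exact: (subgV sT)].
suff [t [d [Tt Dd ->]]] : exists t d, [/\ T t, D d & g = t * d].
  by exists t, d; split=> //; exact: D_dyadic.
move: g gK; apply: gen_ind => [|g z [->|->]|g z [->|->]].
- by exists 1, 1; split; [exact: (subg1 sT) | exact: (subg1 sD) | rewrite mulg1].
- case=> t [d [Tt Dd ->]]; exists (t * x), (d ^ x).
  by split; [exact: (subgM sT) | exact: DJx | group_normalize].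
- case=> t [d [Tt Dd ->]]; exists (t / (c / y)), (d ^ (c / y)^-1 * c); split.
  + by case: sT => _; apply.
  + by apply: (subgM sD) => //; exact: DJrV.
  + by group_normalize.
- case=> t [d [Tt Dd ->]]; exists (t / x), (d ^ x^-1).
  by split; [case: sT => _; apply | exact: DJxV | group_normalize].
- case=> t [d [Tt Dd ->]]; exists (t * (c / y)), ((d / c) ^ (c / y)); split.
  + exact: (subgM sT).
  + by apply: DJr; case: sD => _; apply.
  + by group_normalize.
Qed.

(** The four generators fix 0 and c is mapped to the translation by 1. So if an
    element fixes 0, then its dyadic factor is mapped to 1, the power of c attached
    to this factor is trivial, and the factor lies in the subgroup. *)
Lemma bs_subgroup_fix0 (G : groupType) (x y : G)
    (rho : {multiplicative G -> affine}) :
  metabelian G ->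
  slope (rho x) = (2%:R^-1)%R -> shift (rho x) = 0%R ->
  slope (rho y) = 1%R -> shift (rho y) = 1%R ->
  forall g, subgroup_gen [set z | z = x \/ z = y] g ->
    bs_subgroup x y g <-> shift (rho g) = 0%R.
Proof.
move=> metG mx sx my sy g gK; have sT : is_subgroup (bs_subgroup x y).
  exact: is_subgroup_gen.
have fix0T t : bs_subgroup x y t -> shift (rho t) = 0%R.
  move=> /(_ [set t | shift (rho t) = 0%R]); apply.
    split=> [|a b] /=; first by rewrite hom1.
    by rewrite homF !affineE => -> ->; ring.
  move=> z /=; rewrite !inE /bs_comm => /or4P [] /eqP ->;
    by rewrite /conjg ?(homV, gmulfM, affineE) ?mx ?my ?sx ?sy; field.
split=> [/fix0T //|].
have [t [d [Tt [Ad [n [u [Cu Tdu]]]] ->]]] := bs_factor metG gK.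
rewrite gmulfM affineE (fix0T t Tt) add0r => /eqP.
rewrite mulf_eq0 gt_eqF ?slope_gt0 //= => /eqP sd.
have rho_d : rho d = 1 by apply: affine_inj => //; exact: slope_hom_derived.
have rho_c : slope (rho (bs_comm x y)) = 1%R /\ shift (rho (bs_comm x y)) = 1%R.
  by rewrite /bs_comm /conjg ?(homV, gmulfM, affineE) mx my sx sy; split; field.
have u1 : u = 1.
  have := fix0T _ Tdu; rewrite gmulfM homJ rho_d conj1g mul1g.
  have shift_c k : shift (rho (bs_comm x y ^+ k)) = k%:R%R.
    rewrite homX shiftX (proj1 rho_c) (proj2 rho_c) mul1r.
    by under eq_bigr do rewrite expr1n; rewrite sumr_const card_ord.
  have [k [->|->]] := cyclicP Cu; rewrite ?homV ?affineE shift_c => /eqP.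
    by rewrite pnatr_eq0 => /eqP ->.
  rewrite oppr_eq0 mulf_eq0 invr_eq0 gt_eqF ?slope_gt0 //= pnatr_eq0 => /eqP ->.
  by rewrite invg1.
apply: (subgM sT) => //; rewrite -[d](conjgK (x ^+ n)); apply: (subgJ sT).
  by rewrite -[d ^ _]mulg1 -u1.
apply: (subgV sT); apply: (subgX _ sT); apply: sub_gen.
by rewrite /= inE eqxx.
Qed.

Theorem mainTheorem1 (Phi : groupType) :
  is_free_metabelian Phi ->
  ~ is_cyclic Phi ->
  exists H : set Phi,
    [/\ is_subgroup H,
        finitely_generated H,
        is_isolated H &
        ~ is_separable is_nilpotent H].
Proof.
move=> /free_metabelian_basis [Z basisZ] ncyc; have [genZ metPhi univ] := basisZ.
have [x [y [Zx Zy xy]]] := noncyclic_basis basisZ ncyc.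
have yx : (y == x) = false by apply/eqP => yx; exact: xy.
have sT : is_subgroup (bs_subgroup x y) := is_subgroup_gen _.
set K := subgroup_gen [set z | z = x \/ z = y].
have sK : is_subgroup K := is_subgroup_gen _.
have Kx : K x by apply: sub_gen; left.
have Ky : K y by apply: sub_gen; right.
have TK t : bs_subgroup x y t -> K t.
  apply=> // z; rewrite /= !inE /bs_comm.
  by case/or4P => /eqP ->;
    do ![exact: Kx | exact: Ky | apply: (subgM sK) | apply: (subgV sK)].
have [rho rhoE] : exists rho : {multiplicative Phi -> affine}, forall z, Z z ->
    slope (rho z) = (if z == x then 2%:R^-1 else 1)%R /\
    shift (rho z) = (if z == x then 0 else 1)%R.
  by apply: (affine_hom _ basisZ) => z; case: eqP; rewrite // invr_gt0.
have [] := rhoE x Zx; rewrite eqxx => mx sx.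
have [] := rhoE y Zy; rewrite yx => my sy.
have fix0 := bs_subgroup_fix0 metPhi mx sx my sy.
have [r rE] := univ _ (fun z => if (z == x) || (z == y) then z else 1) metPhi.
have r_id g : K g -> r g = g.
  move=> /(_ [set g | r g = g]); apply.
    by split=> [|a b /= ra rb] /=; rewrite ?hom1 // homF ra rb.
  by move=> z [->|->] /=; rewrite rE // eqxx ?orbT.
have rK g : K (r g).
  have : subgroup_gen Z g by rewrite genZ.
  move=> /(_ (r @^-1` K)); apply; first exact: is_subgroup_preimage.
  move=> z Zz /=; rewrite rE //; case: ifP => [/orP [] /eqP -> //|_].
  exact: (subg1 sK).
exists (bs_subgroup x y); split=> //.
- by exists (bs_seq x y).
- move=> g m m_gt0 Tgm.
  have rg : r g = g.
    by apply: (root_uniq basisZ m_gt0); rewrite -homX r_id //; exact: TK.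
  have Kg : K g by rewrite -rg.
  apply/(fix0 g Kg)/(affine_root_fix0 m_gt0); rewrite -homX.
  by apply/fix0 => //; exact: TK.
- have nTy : ~ bs_subgroup x y y.
    by move=> /(fix0 y Ky); rewrite sy => /eqP; rewrite oner_eq0.
  move=> /(_ y nTy) [N [phi [nilN]]]; apply.
  have sub_phiT := is_subgroup_image phi sT.
  apply: (nilpotent_mem (x := phi x) nilN sub_phiT).
    by exists x => //; apply: sub_gen; rewrite /= inE eqxx.
  exists (bs_comm x y / y); last by rewrite !homF homJ.
  by apply: sub_gen; rewrite /= !inE eqxx orbT.
Qed.
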